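(* Let $P$ and $Q$ be labeled posets on $[n]$ and $[m]$, respectively. If the multivariate Eulerian polynomials $A_P(\mathbf{z})$ and $A_Q(\mathbf{z})$ are stable, then so is $A_{P\sqcup Q}(\mathbf{z})$.
   Context: Write $[n]=\{1,\dots,n\}$ and let $[n]'=\{i' : i\in[n]\}$ be a disjoint copy of $[n]$. A labeled poset on $n$ elements is a poset $P=([n],\preceq)$; the natural order on $[n]$ is denoted $\leq$. Its Jordan–Hölder set is $$\mathscr{L}(P)=\{\pi\in\mathfrak{S}_n : \text{for all } i,j\in[n],\ \pi_i\preceq\pi_j \text{ implies } i\leq j\},$$ where permutations $\pi=\pi_1\pi_2\cdots\pi_n$ are written in one-line notation. For $\pi\in\mathfrak{S}_n$ set $\pi_0=\pi_{n+1}=\infty$ and define the ascent bottoms and descent bottoms $$\mathrm{AB}(\pi)=\{\pi_i\in[n]:\pi_i<\pi_{i+1}\},\qquad \mathrm{DB}(\pi)=\{\pi_i\in[n]:\pi_{i-1}>\pi_i\}.$$ In variables $\mathbf{z}=\{z_e : e\in[n]\cup[n]'\}$ put $w_1(\pi)=\prod_{e\in\mathrm{DB}(\pi)}z_e\prod_{e\in\mathrm{AB}(\pi)}z_{e'}$. The multivariate $P$-Eulerian polynomial is $A_P(\mathbf{z})=\sum_{\pi\in\mathscr{L}(P)}w_1(\pi)$. The disjoint union of $P=([n],\preceq_P)$ and $Q=([m],\preceq_Q)$ is the labeled poset $P\sqcup Q=([n+m],\preceq)$ whose set of relations is $\{i\preceq j : i,j\in[n],\ i\preceq_P j\}\cup\{(n+i)\preceq(n+j):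 i,j\in[m],\ i\preceq_Q j\}$. A polynomial with complex coefficients is stable if it is nonzero whenever all its variables have positive imaginary parts. *)

(* Defs.v *)
From HB Require Import structures.
From mathcomp Require Import all_boot all_order all_algebra all_fingroup.
From mathcomp Require Import reals.
From mathcomp Require Import complex mpoly.

Set Implicit Arguments.
Unset Strict Implicit.
Unset Printing Implicit Defensive.

Import Order.TTheory GRing.Theory Num.Theory.
Local Open Scope ring_scope.

(** The ground set [n] = {1, ..., n} is represented by ['I_n] = {0, ..., n-1},
    so that all labels, positions and letters are shifted down by one. *)

Record lposet (n : nat) := LPoset {
  lpo_rel :> rel 'I_n;
  lpo_refl : reflexive lpo_rel;
  lpo_anti : antisymmetric lpo_rel;
  lpo_trans : transitive lpo_rel }.

Section DisjointUnion.
Variables (n m : nat) (P : lposet n) (Q : lposet m).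

(** [split] sends [lshift m i] to [inl i] and [rshift n j], whose value is
    [n + j], to [inr j]. *)
Definition dunion_rel : rel 'I_(n + m) := fun x y =>
  match split x, split y with
  | inl i, inl j => P i j
  | inr i, inr j => Q i j
  | _, _ => false
  end.

Lemma dunion_refl : reflexive dunion_rel.
Proof.
by move=> x; rewrite /dunion_rel; case: (split x) => i; apply: lpo_refl.
Qed.

Lemma dunion_anti : antisymmetric dunion_rel.
Proof.
move=> x y; rewrite /dunion_rel => Hxy; apply: (can_inj splitK).
by case: (split x) (split y) Hxy => i [] j // /lpo_anti ->.
Qed.

Lemma dunion_trans : transitive dunion_rel.
Proof.
move=> y x z; rewrite /dunion_rel.
by case: (split x) (split y) (split z) => i [] j [] k //; apply: lpo_trans.
Qed.

Definition dunion : lposet (n + m) :=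
  LPoset dunion_refl dunion_anti dunion_trans.

End DisjointUnion.

(** A permutation [s : 'S_n] stands for the word s(0) s(1) ... s(n-1). *)
Definition jordan_holder n (P : lposet n) : {set 'S_n} :=
  [set s : 'S_n | [forall i, forall j, P (s i) (s j) ==> (i <= j)%N]].

(** [letter s k] is the k-th letter of the word of [s], with positions counted
    from 1, extended by infinity at positions 0 and n+1.  The actual letters
    are smaller than n, so the number n plays the role of infinity. *)
Definition letter n (s : 'S_n) (k : nat) : nat :=
  if k is k'.+1 then
    if insub k' is Some i then nat_of_ord (s i) else n
  else n.

Definition asc_bottoms n (s : 'S_n) : {set 'I_n} :=
  [set s i | i : 'I_n & (letter s i.+1 < letter s i.+2)%N].

Definition desc_bottoms n (s : 'S_n) : {set 'I_n} :=
  [set s i | i : 'I_n & (letter s i > letter s i.+1)%N].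

Section Eulerian.
Variables (C : comNzRingType) (n : nat).

(** The variables z_e and z_e' are ['X_(lshift n e)] and ['X_(rshift n e)]. *)
Definition eulerian_weight (s : 'S_n) : {mpoly C[n + n]} :=
  (\prod_(e in desc_bottoms s) 'X_(lshift n e)) *
  (\prod_(e in asc_bottoms s) 'X_(rshift n e)).

Definition eulerian_poly (P : lposet n) : {mpoly C[n + n]} :=
  \sum_(s in jordan_holder P) eulerian_weight s.

End Eulerian.

Definition stable (R : realType) k (p : {mpoly R[i][k]}) : Prop :=
  forall z : 'I_k -> R[i], (forall e, 0 < complex.Im (z e)) -> p.@[z] != 0.

(* Main.v *)
(** Cutting a word of [P |_| Q] into blocks of small (<= n) and large (> n)
    letters writes it as a shuffle of a word [u] of [P] and a word [v] of [Q].
    Each gap between neighbouring letters carries exactly one variable.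
    Inserting large letters into an inner gap [x y] of [u] replaces its variable
    by [z_x' z_y], while inserting small letters into a gap of [v] replaces its
    variable by [1]; since blocks alternate, the number of interrupted gaps of
    [v] exceeds by one the number of interrupted inner gaps of [u].  Hence, for
    nonempty [P] and [Q],
      A_(P |_| Q) = \sum_k [t^k] F(t) [s^(k+1)] H(s),
      F(t) = \prod_e (1 + t z_e) A_P(z / (1 + t z)),   H(s) = A_Q(z + s).
    If all variables lie in the open upper half-plane, [F] has no zero in
    [Im t <= 0] and [H] none in [Im s >= 0].  The displayed sum is a coefficient
    of the product of [H] with the reversal of [F], a polynomial whose zeros all
    lie in the open lower half-plane; by Gauss-Lucas so do those of its
    derivatives, and thus none of its coefficients up to its degree vanishes. *)

Require Import Defs.
From mathcomp Require Import all_boot all_order all_algebra all_fingroup.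
From mathcomp Require Import reals.
From mathcomp Require Import complex mpoly.
From mathcomp Require Import zify ring lra.

Set Implicit Arguments.
Unset Strict Implicit.
Unset Printing Implicit Defensive.

Import Order.TTheory GRing.Theory Num.Theory.

(** * Shuffles of words *)

Section Shuffle.
Variable T : eqType.
Implicit Types (u v w : seq T) (lo : pred T).

Lemma filter_predC_nil (p : pred T) s : all (predC p) s -> filter p s = [::].
Proof. by rewrite all_predC has_filter negbK => /eqP. Qed.

Fixpoint shuffles u v : seq (seq T) :=
  if u is x :: u' then
    (fix shuffles_u v := if v is y :: v' then
       map (cons x) (shuffles u' v) ++ map (cons y) (shuffles_u v')
     else [:: u]) v
  else [:: v].

Lemma shuffles_nilr u : shuffles u [::] = [:: u].
Proof. by case: u. Qed.

Lemma shuffles_cons x u y v :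
  shuffles (x :: u) (y :: v) =
    map (cons x) (shuffles u (y :: v)) ++ map (cons y) (shuffles (x :: u) v).
Proof. by []. Qed.

Lemma mem_map_cons x y w (s : seq (seq T)) :
  (x :: w \in map (cons y) s) = (x == y) && (w \in s).
Proof.
apply/mapP/andP => [[w' w's [-> ->]]|[/eqP-> ws]]; first by rewrite eqxx.
by exists w.
Qed.

Lemma nil_map_cons y (s : seq (seq T)) : ([::] \in map (cons y) s) = false.
Proof. by apply/mapP => -[]. Qed.

(** Letters of [u] satisfy [lo] and those of [v] do not, so the first letter of [w] decides which of
    the two sublists of the recursion can contain it. *)
Lemma mem_shuffles lo u v w : all lo u -> all (predC lo) v ->
  (w \in shuffles u v) =
    (filter lo w == u) && (filter (predC lo) w == v).
Proof.
elim: u v w => [|x u IHu] v w /=.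
  move=> _ v_hi; rewrite inE; apply/eqP/andP => [->|[/eqP w0 /eqP<-]].
    split; apply/eqP; last exact/all_filterP.
    exact: filter_predC_nil.
  apply/esym/all_filterP; rewrite all_predC has_filter w0; exact/eqP.
move=> /andP[lo_x lo_u].
elim: v w => [|y v IHv] w /=.
  move=> _; rewrite inE; apply/eqP/andP => [->|[/eqP<- /eqP w0]].
    split; rewrite /= lo_x /= ?(all_filterP lo_u) ?eqxx //.
    apply/eqP; apply: filter_predC_nil; rewrite (eq_all (a2 := lo)) // => z /=.
    by rewrite negbK.
  apply/esym/all_filterP; move/eqP: w0; rewrite -[_ == _]negbK -has_filter.
  by rewrite -all_predC (eq_all (a2 := lo)) // => z /=; rewrite negbK.
move=> /andP[hi_y hi_v]; rewrite mem_cat.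
case: w => [|c w]; first by rewrite !nil_map_cons.
rewrite !mem_map_cons IHu //= ?hi_y // IHv //=.
have [lo_c|hi_c] := boolP (lo c); rewrite /= eqseq_cons.
  have /negbTE-> : c != y by apply: contraNneq hi_y => <-.
  by rewrite orbF andbA.
have /negbTE-> : c != x by apply: contraNneq hi_c => ->.
by rewrite [RHS]andbCA.
Qed.

Lemma shuffles_uniq lo u v :
  all lo u -> all (predC lo) v -> uniq (shuffles u v).
Proof.
elim: u v => [|x u IHu] v //= /andP[lo_x lo_u].
elim: v => [|y v IHv] //= /andP[hi_y hi_v].
rewrite cat_uniq !map_inj_uniq ?IHu ?IHv /= ?hi_y ?hi_v // ?andbT;
  try by move=> ? ? [].
apply/hasPn => _ /mapP[w _ ->]; rewrite /= mem_map_cons.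
by rewrite (_ : (y == x) = false) //; apply: contraNF hi_y => /eqP->.
Qed.

End Shuffle.

Local Open Scope ring_scope.

(** * Weights of words *)

Section Weight.
Variables (C : comNzRingType) (a b : nat -> C).
Implicit Types (u v w : seq nat) (x y : nat).

(** The variable carried by the gap between consecutive letters [x], [y]: the
    ascent bottom [x] or the descent bottom [y]; [a e] and [b e] are the values
    of z_e and z_e'. *)
Definition gap x y : C := if (x < y)%N then b x else a y.

Fixpoint tail_weight x w : C :=
  if w is y :: w' then gap x y * tail_weight y w' else b x.

Definition weight w : C := if w is x :: w' then a x * tail_weight x w' else 1.

(** ['X] marks the inner gaps of [x :: u] into which larger letters are
    inserted; the final gap, before infinity, keeps its variable either way. *)
Fixpoint lo_tail_poly x u : {poly C} :=
  if u is y :: u' then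
    ((gap x y)%:P + (b x * a y) *: 'X) * lo_tail_poly y u'
  else (b x)%:P.

(** ['X] marks the gaps of [x :: v] into which smaller letters are inserted;
    such a gap loses its variable. *)
Fixpoint hi_tail_poly x v : {poly C} :=
  if v is y :: v' then ((gap x y)%:P + 'X) * hi_tail_poly y v'
  else (b x)%:P + 'X.

Lemma size_lo_tail_poly x u : (size (lo_tail_poly x u) <= (size u).+1)%N.
Proof.
elim: u x => [|y u IH] x /=; first exact: size_polyC_leq1.
apply: leq_trans (size_polyMleq _ _) _.
have h : (size ((gap x y)%:P + (b x * a y) *: 'X)%R <= 2)%N.
  apply: leq_trans (size_polyD _ _) _; rewrite geq_max.
  rewrite (leq_trans (size_polyC_leq1 _)) //=.
  by rewrite (leq_trans (size_scale_leq _ _)) // size_polyX.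
by have := IH y; lia.
Qed.

Lemma lo_tail_poly0 x u : (lo_tail_poly x u)`_0 = tail_weight x u.
Proof.
by elim: u x => [|y u IH] x /=; rewrite ?coefC // coef0M IH !coefE mulr0 addr0.
Qed.

Lemma hi_tail_poly0 x v : (hi_tail_poly x v)`_0 = tail_weight x v.
Proof.
by elim: v x => [|y u IH] x /=; rewrite ?coef0M ?IH !coefE addr0.
Qed.

Lemma coef_lo_tail_poly_cons x y u k :
  (lo_tail_poly x (y :: u))`_k = gap x y * (lo_tail_poly y u)`_k +
    (if k is k'.+1 then b x * a y * (lo_tail_poly y u)`_k' else 0).
Proof.
rewrite /= mulrDl coefD coefCM -scalerAl coefZ coefXM.
by case: k => [|k] //=; rewrite mulr0.
Qed.

Lemma coef_hi_tail_poly_cons x y v k :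
  (hi_tail_poly x (y :: v))`_k.+1 =
    gap x y * (hi_tail_poly y v)`_k.+1 + (hi_tail_poly y v)`_k.
Proof. by rewrite /= mulrDl coefD coefCM coefXM. Qed.

Variable n : nat.

(** The last letter read is either a small [x], the word [y :: v] being still
    to come in full, or a large [y]; in the second case the small letters
    resume in a gap of [y :: v], whence the shift of the index. *)
Lemma sum_shuffles_tail u v y :
  all (gtn n) u -> all (leq n) (y :: v) ->
  (forall x, (x < n)%N ->
    \sum_(w <- shuffles u (y :: v)) tail_weight x w =
      \sum_(k < (size u).+1) (lo_tail_poly x u)`_k * (hi_tail_poly y v)`_k) /\
  (forall x u', u = x :: u' ->
    \sum_(w <- shuffles u v) tail_weight y w =
      a x * \sum_(k < (size u').+1)
        (lo_tail_poly x u')`_k * (hi_tail_poly y v)`_k.+1).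
Proof.
have lohi x z : (x < n)%N -> (n <= z)%N -> gap x z = b x.
  by move=> xn nz; rewrite /gap (leq_trans xn nz).
have hilo x z : (x < n)%N -> (n <= z)%N -> gap z x = a x.
  by move=> xn nz; rewrite /gap ltnNge (ltnW (leq_trans xn nz)).
elim: u v y => [|x' u IHu] v y.
  move=> _ /= /andP[ny _]; split=> // x xn.
  by rewrite big_ord1 big_seq1 /= coefC hi_tail_poly0 lohi.
move=> /[dup] allu /= /andP[x'n un] /[dup] allv /= /andP[ny vn].
have second x u' : x' :: u = x :: u' ->
  \sum_(w <- shuffles (x' :: u) v) tail_weight y w =
    a x * \sum_(k < (size u').+1)
      (lo_tail_poly x u')`_k * (hi_tail_poly y v)`_k.+1.
  case=> <- <- {x u'}.
  elim: v y ny vn {allv} => [|y' v IHv] y ny /=.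
    move=> _; rewrite big_seq1 /= hilo // big_ord_recl big1.
      by rewrite addr0 !coefE add0r mulr1 lo_tail_poly0.
    by move=> i _; rewrite !coefE addr0 mulr0.
  move=> /andP[ny' vn]; rewrite big_cat !big_map /= -!mulr_sumr.
  rewrite hilo // IHv //.
  have [|-> // _] := IHu v y' un; first by rewrite /= ny' vn.
  rewrite mulrCA -mulrDr addrC mulr_sumr -big_split /=; congr (_ * _).
  apply: eq_bigr => i _; rewrite (coef_hi_tail_poly_cons y y' v) mulrDr.
  by rewrite mulrCA.
split=> // x xn.
rewrite big_cat !big_map /= -!mulr_sumr (second _ _ erefl).
have [-> // _] := IHu v y un allv.
rewrite (lohi x y) //.
under [RHS]eq_bigr do rewrite (coef_lo_tail_poly_cons x x' u) mulrDl.
rewrite big_split /=; congr (_ + _).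
  rewrite [in RHS]big_ord_recr /= [(lo_tail_poly x' u)`__]nth_default;
    last exact: size_lo_tail_poly.
  rewrite mulr0 mul0r addr0.
  by rewrite mulr_sumr; apply: eq_bigr => i _; rewrite mulrA.
rewrite [in RHS]big_ord_recl /= mul0r add0r mulrA mulr_sumr.
by apply: eq_bigr => i _; rewrite /= mulrA.
Qed.

(** The gap before the first small letter carries [a x] even if large letters precede it, so it gets
    no marker. *)
Definition lo_poly u : {poly C} :=
  if u is x :: u' then a x *: lo_tail_poly x u' else 1.

(** Small letters in front of the word replace its initial variable [a y] by 1, whence one more
    factor with ['X]. *)
Definition hi_poly v : {poly C} :=
  if v is y :: v' then ((a y)%:P + 'X) * hi_tail_poly y v' else 1.

(** Shuffles starting with a small letter interrupt the initial gap of [v] and give the ['X] term of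
    the first factor of [hi_poly]; the others give its constant term. *)
Lemma sum_shuffles u v :
  all (gtn n) u -> all (leq n) v -> u != [::] -> v != [::] ->
  \sum_(w <- shuffles u v) weight w =
    \sum_(k < size u) (lo_poly u)`_k * (hi_poly v)`_k.+1.
Proof.
case: u v => [|x u] [|y v] // allu allv _ _.
move: (allu) (allv) => /= /andP[xn un] /andP[ny vn].
rewrite big_cat !big_map /= -!mulr_sumr.
have [-> // _] := sum_shuffles_tail un allv.
have [_ /(_ x u erefl)->] := sum_shuffles_tail allu allv.
rewrite mulrCA -mulrDr mulr_sumr -big_split mulr_sumr /=.
apply: eq_bigr => i _.
by rewrite coefZ mulrDl coefD coefCM coefXM /=; ring.
Qed.

Lemma size_lo_poly u : u != [::] -> (size (lo_poly u) <= size u)%N.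
Proof.
case: u => // x u _ /=.
exact: leq_trans (size_scale_leq _ _) (size_lo_tail_poly _ _).
Qed.

Lemma hi_tail_poly_monic y v :
  hi_tail_poly y v \is monic /\ size (hi_tail_poly y v) = (size v).+2.
Proof.
elim: v y => [|z v IH] y /=; first by rewrite addrC monicXaddC size_XaddC.
have [mon sz] := IH z; have monX := monicXaddC (gap y z).
rewrite addrC monicMl // size_Mmonic ?monic_neq0 // size_XaddC sz.
by rewrite addSn.
Qed.

(** All factors are monic, so in characteristic zero the leading terms cannot cancel in a sum over
    words of equal length. *)
Lemma lead_hi_poly v : v != [::] ->
  size (hi_poly v) = (size v).+2 /\ (hi_poly v)`_(size v).+1 = 1.
Proof.
case: v => // y v _ /=.
have [mon sz] := hi_tail_poly_monic y v.
have sz' : size (((a y)%:P + 'X) * hi_tail_poly y v) = (size v).+3.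
  by rewrite addrC size_Mmonic ?monic_neq0 ?monicXaddC // size_XaddC sz.
split=> //; rewrite -[_.+2]/((size v).+3.-1) -sz'.
by apply/eqP; rewrite -/(lead_coef _) -monicE addrC monicMl ?monicXaddC.
Qed.

End Weight.

Lemma horner_hi_poly (C : comNzRingType) (a b : nat -> C) v s :
  (hi_poly a b v).[s] = weight (fun e => a e + s) (fun e => b e + s) v.
Proof.
case: v => [|y v] /=; first by rewrite hornerE.
rewrite !hornerE; congr (_ * _).
elim: v y => [|z v IH] y /=; rewrite !hornerE // IH.
by rewrite /gap; case: ltnP.
Qed.

(** For ascents and descents alike, an inner gap factor is the new [gap x y] times
    [(1 + t * b x) * (1 + t * a y)]; the two end gaps supply the remaining factors, with [a] of the
    first letter and [b] of the last. *)
Lemma horner_lo_poly (C : fieldType) (a b : nat -> C) u t :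
    (forall e, 1 + t * a e != 0) -> (forall e, 1 + t * b e != 0) ->
  (lo_poly a b u).[t] =
    (\prod_(e <- u) ((1 + t * a e) * (1 + t * b e))) *
      weight (fun e => a e / (1 + t * a e)) (fun e => b e / (1 + t * b e)) u.
Proof.
move=> ta tb; case: u => [|x u] /=; first by rewrite hornerE big_nil mulr1.
set a' := fun e => a e / _; set b' := fun e => b e / _.
suff : (lo_tail_poly a b x u).[t] = (1 + t * b x) *
    (\prod_(e <- u) ((1 + t * a e) * (1 + t * b e))) * tail_weight a' b' x u.
  rewrite hornerZ big_cons => ->; rewrite /a'; field; exact: ta.
elim: u x => [|y u IH] x /=.
  by rewrite hornerE big_nil /b' /=; field; exact: tb.
rewrite !hornerE IH big_cons /gap /a' /b' /=.
by case: ltnP => _; field; rewrite ?ta ?tb.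
Qed.

(** * Polynomials without zeros in the upper half-plane *)

Lemma size_deriv_num (F : numDomainType) (p : {poly F}) :
  size p^`() = (size p).-1.
Proof.
have [->|p0] := eqVneq p 0; first by rewrite deriv0 size_poly0.
apply/eqP; rewrite eqn_leq; apply/andP; split.
  by rewrite -ltnS prednK ?size_poly_gt0 // lt_size_deriv.
case sp: (size p) => [|[|k]] //=; rewrite ltnNge; apply/negP => /leq_sizeP.
move=> /(_ k (leqnn _)) /eqP; rewrite coef_deriv mulrn_eq0 /=.
have -> : p`_k.+1 = lead_coef p by rewrite lead_coefE sp.
by rewrite lead_coef_eq0 (negbTE p0).
Qed.

Lemma horner_deriv_prod_XsubC (F : fieldType) (s : seq F) x :
    (forall r, r \in s -> x != r) ->
  (\prod_(r <- s) ('X - r%:P))^`().[x] =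
    (\prod_(r <- s) ('X - r%:P)).[x] * \sum_(r <- s) (x - r)^-1.
Proof.
elim: s => [|r s IH] xs; first by rewrite !big_nil derivC !hornerE.
have xr : x - r != 0 by rewrite subr_eq0 xs ?mem_head.
rewrite !big_cons derivM derivXsubC !hornerE IH => [|q qs].
  by field.
by rewrite xs // in_cons qs orbT.
Qed.

Section HalfPlane.
Variable R : realType.
Local Notation C := R[i].
Local Notation Im := complex.Im.
Implicit Types (x y z t : C) (p q : {poly C}).

Lemma ImD x y : Im (x + y) = Im x + Im y.
Proof. by case: x y => ? ? []. Qed.

Lemma ImN x : Im (- x) = - Im x.
Proof. by case: x. Qed.

Lemma Im_neq0 x : Im x != 0 -> x != 0.
Proof. by apply: contraNneq => ->. Qed.

Lemma ImV_lt0 x : 0 < Im x -> Im x^-1 < 0.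
Proof.
case: x => r i /= i0; rewrite oppr_lt0 divr_gt0 //.
by rewrite ltr_wpDl ?sqr_ge0 ?exprn_gt0.
Qed.

Lemma ImV_gt0 x : Im x < 0 -> 0 < Im x^-1.
Proof.
by move=> x0; rewrite -[x]opprK invrN ImN oppr_gt0 ImV_lt0 // ImN oppr_gt0.
Qed.

Lemma ImV_le0 x : 0 <= Im x -> Im x^-1 <= 0.
Proof.
case: x => r i /= i0; rewrite oppr_le0 divr_ge0 //.
by rewrite addr_ge0 ?sqr_ge0.
Qed.

(** Inversion exchanges the open half-planes, and translation by [t] preserves the lower one; this
    yields both the nonvanishing here and the positivity in the next lemma. *)
Lemma one_addM_neq0 t z : Im t <= 0 -> 0 < Im z -> 1 + t * z != 0.
Proof.
move=> t0 z0; have zn0 : z != 0 by rewrite Im_neq0 // gt_eqF.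
have -> : 1 + t * z = z * (z^-1 + t) by field.
by rewrite mulf_neq0 // Im_neq0 // ImD lt_eqF // ltr_wnDr // ImV_lt0.
Qed.

Lemma Im_moebius_gt0 t z : Im t <= 0 -> 0 < Im z -> 0 < Im (z / (1 + t * z)).
Proof.
move=> t0 z0; have zn0 : z != 0 by rewrite Im_neq0 // gt_eqF.
have den := one_addM_neq0 t0 z0.
have -> : z / (1 + t * z) = (z^-1 + t)^-1.
  by field; rewrite zn0 den.
apply: ImV_gt0; by rewrite ImD ltr_wnDr // ImV_lt0.
Qed.

Definition lower_roots p := forall x, 0 <= Im x -> p.[x] != 0.

(** Gauss-Lucas for the closed upper half-plane: the summands of the
    logarithmic derivative all have negative imaginary part. *)
Lemma lower_roots_deriv p :
  lower_roots p -> (1 < size p)%N -> lower_roots p^`().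
Proof.
move=> lp sp x x0; have [rs prs] := closed_field_poly_normal p.
have p0 : p != 0 by rewrite -size_poly_gt0 (ltn_trans _ sp).
have lc0 : lead_coef p != 0 by rewrite lead_coef_eq0.
have rsP r : r \in rs -> Im r < 0.
  move=> r_rs; rewrite ltNge; apply/negP => /lp; rewrite prs hornerZ.
  rewrite mulf_eq0 negb_or lc0 /= -/(root _ _) => /negP[].
  by rewrite root_prod_XsubC.
have szrs : size p = (size rs).+1.
  by rewrite prs size_scale // size_prod_XsubC.
rewrite prs derivZ hornerZ horner_deriv_prod_XsubC; last first.
  by move=> r /rsP r0; apply: contraTneq x0 => ->; rewrite -ltNge.
rewrite mulrA -hornerZ -prs mulf_neq0 ?lp // Im_neq0 // lt_eqF //.
(* The size bound provides a root, whose summand is strictly negative; the remaining summands only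
   need to be nonpositive. *)
move: sp; rewrite szrs ltnS {prs szrs}.
case: rs rsP => // r rs rsP _; rewrite big_cons ImD ltr_wnDr //; last first.
  by rewrite ImV_lt0 // ImD ImN; have := rsP r (mem_head _ _); lra.
have {rsP} : forall r1, r1 \in rs -> Im r1 < 0.
  by move=> r1 qrs; rewrite rsP // in_cons qrs orbT.
elim: rs => [|r1 rs IH] rsP; first by rewrite big_nil.
rewrite big_cons ImD -[leRHS]addr0 lerD ?IH //.
  by rewrite ltW // ImV_lt0 // ImD ImN; have := rsP r1 (mem_head _ _); lra.
by move=> r2 qrs; rewrite rsP // in_cons qrs orbT.
Qed.

(** The constant coefficient is the value at 0, a point of the closed upper half-plane;
    differentiation brings each higher coefficient down to it. *)
Lemma lower_roots_coef p k : lower_roots p -> (k < size p)%N -> p`_k != 0.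
Proof.
elim: k p => [|k IH] p lp kp.
  by rewrite -horner_coef0 lp.
have sp : (1 < size p)%N by lia.
have := IH _ (lower_roots_deriv lp sp).
rewrite size_deriv_num coef_deriv mulrn_eq0 /= => -> //.
by rewrite -ltnS prednK ?(ltnW sp).
Qed.

(** With [d] the degree of [f] and [g] its reversal, the sum is the coefficient of index [d + 1] in
    [g * h]; [1 < size h] keeps this index within the degree. *)
Lemma sum_coef_neq0 (f h : {poly C}) N :
    (forall t, Im t <= 0 -> f.[t] != 0) -> lower_roots h ->
    (size f <= N)%N -> (1 < size h)%N ->
  \sum_(k < N) f`_k * h`_k.+1 != 0.
Proof.
move=> f0 h0 sfN sh.
have f00 : f`_0 != 0 by rewrite -horner_coef0 f0.
have fn0 : f != 0 by apply: contraNneq f00 => ->; rewrite coef0.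
have sf : (0 < size f)%N by rewrite size_poly_gt0.
pose d := (size f).-1; have sfd : size f = d.+1 by rewrite prednK.
pose g := \poly_(k < d.+1) f`_(d - k).
have sg : size g = d.+1 by rewrite size_poly_eq // subnn.
have g0 : lower_roots g.
  (* The reversal identity needs [x] invertible; at 0 the value of [g] is the leading coefficient of
     [f]. *)
  move=> x x0; have [->|xn0] := eqVneq x 0.
    rewrite horner_coef0 coef_poly /= subn0 -[f`_d]/(lead_coef f).
    by rewrite lead_coef_eq0.
  suff -> : g.[x] = x ^+ d * f.[x^-1].
    by rewrite mulf_neq0 ?expf_neq0 // f0 // ImV_le0.
  rewrite horner_poly horner_coef sfd mulr_sumr.
  rewrite (reindex_inj rev_ord_inj) /=; apply: eq_bigr => -[i /= id] _.
  have idd : (i <= d)%N by [].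
  rewrite subSS subKn // mulrCA; congr (_ * _).
  by rewrite exprVn -expfB_cond // (negbTE xn0).
have := lower_roots_coef (p := g * h) (k := d.+1).
have gh0 : lower_roots (g * h).
  by move=> x x0; rewrite hornerM mulf_neq0 ?g0 ?h0.
have hn0 : h != 0 by rewrite -size_poly_gt0 (ltn_trans _ sh).
have gn0 : g != 0 by rewrite -size_poly_gt0 sg.
rewrite size_mul // sg => /(_ gh0) /(_ _); rewrite coefM big_ord_recr /=.
rewrite [g`_d.+1]nth_default ?sg // mul0r addr0.
rewrite (reindex_inj rev_ord_inj) /= => h1.
suff -> : \sum_(k < N) f`_k * h`_k.+1 = \sum_(k < d.+1) f`_k * h`_k.+1.
  rewrite (eq_bigr (fun j : 'I_d.+1 =>
      g`_(d.+1 - j.+1) * h`_(d.+1 - (d.+1 - j.+1)))).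
    by apply: h1; rewrite -addn2 leq_add2l.
  move=> [i /= id] _; rewrite coef_poly subSS ltnS leq_subr subKn //.
  by congr (_ * h`_ _); lia.
rewrite -(big_mkord xpredT (fun k => f`_k * h`_k.+1)).
rewrite (big_cat_nat (n := d.+1)) -?sfd //= big_mkord -[RHS]addr0.
congr (_ + _).
rewrite big_nat big1 // => i /andP[di _].
by rewrite nth_default ?mul0r.
Qed.

End HalfPlane.

(** * Eulerian polynomials as sums over words *)

Section Words.
Variable n : nat.
Implicit Types (s : 'S_n) (P : lposet n) (w : seq nat).

(** Letters are taken in [nat] so that words of [P], of [Q] and of their union share one type. *)
Definition word s : seq nat := [seq nat_of_ord (s i) | i <- enum 'I_n].

Lemma size_word s : size (word s) = n.
Proof. by rewrite size_map size_enum_ord. Qed.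

Lemma nth_word s (i : 'I_n) : nth n (word s) i = s i.
Proof. by rewrite (nth_map i) ?size_enum_ord // nth_ord_enum. Qed.

Lemma word_uniq s : uniq (word s).
Proof. by rewrite map_inj_uniq ?enum_uniq // => i j /val_inj/perm_inj. Qed.

Lemma word_lt s : all (gtn n) (word s).
Proof. by apply/allP => _ /mapP[i _ ->] /=. Qed.

Lemma word_inj : injective word.
Proof.
by move=> s t st; apply/permP => i; apply: val_inj; rewrite /= -!nth_word st.
Qed.

Lemma perm_word s : perm_eq (word s) (iota 0 n).
Proof.
apply: uniq_perm; [exact: word_uniq|exact: iota_uniq|].
apply: (uniq_min_size (word_uniq s) _ _).2 => [x|].
  by move/(allP (word_lt s)) => /=; rewrite mem_iota.
by rewrite size_word size_iota.
Qed.

(** Inclusion of duplicate-free lists, both of length [n!]. *)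
Lemma words_permutations :
  perm_eq [seq word s | s <- enum {: 'S_n}] (permutations (iota 0 n)).
Proof.
have Uw : uniq [seq word s | s <- enum {: 'S_n}].
  by rewrite map_inj_uniq ?enum_uniq //; exact: word_inj.
apply: uniq_perm; [exact: Uw|exact: permutations_uniq|].
apply: (uniq_min_size Uw _ _).2 => [_ /mapP[s _ ->]|].
  by rewrite mem_permutations perm_word.
rewrite size_permutations ?iota_uniq // size_iota size_map -cardE.
have -> : #|{: 'S_n}| = #|perm_on [set: 'I_n]|.
  by apply: eq_card => s; rewrite !inE; apply/esym/subsetP => x; rewrite !inE.
by rewrite card_perm cardsT card_ord.
Qed.

(** Numbers from [n] on are related to nothing, so large letters impose no condition from [P]. *)
Definition nat_rel (P : rel 'I_n) : rel nat := fun x y =>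
  if insub x is Some i then if insub y is Some j then P i j else false
  else false.

Lemma nat_rel_ord (P : rel 'I_n) (i j : 'I_n) : nat_rel P i j = P i j.
Proof. by rewrite /nat_rel !valK. Qed.

Definition compatible (P : rel 'I_n) w :=
  pairwise (fun x y => ~~ nat_rel P y x) w.

Lemma jordan_holder_word P s : (s \in jordan_holder P) = compatible P (word s).
Proof.
rewrite inE; apply/forallP/(pairwiseP n).
  move=> sP i j; rewrite !inE size_word => ni nj ij.
  rewrite (nth_word s (Ordinal ni)) (nth_word s (Ordinal nj)) nat_rel_ord.
  have /forallP/(_ (Ordinal ni))/implyP := sP (Ordinal nj).
  by rewrite leqNgt ij; case: (P _ _) => // /(_ isT).
move=> sP i; apply/forallP => j; apply/implyP => Pij.
rewrite leqNgt; apply/negP => ji.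
have := sP j i; rewrite !inE size_word => /(_ (ltn_ord _) (ltn_ord _) ji).
by rewrite !nth_word nat_rel_ord Pij.
Qed.

End Words.

Section EvalWeight.
Variable C : comNzRingType.

(** This regroups the product over gaps into one over letters. The default [N] of [nth] acts as
    infinity and makes the last letter an ascent bottom. *)
Lemma tail_weight_prod (a b : nat -> C) N x w :
    all (gtn N) (x :: w) -> uniq (x :: w) ->
  tail_weight a b x w =
    (if (x < nth N w 0)%N then b x else 1) * \prod_(i < size w)
      ((if (nth N (x :: w) i > nth N w i)%N then a (nth N w i) else 1) *
       (if (nth N w i < nth N w i.+1)%N then b (nth N w i) else 1)).
Proof.
elim: w x => [|y w IH] x.
  by rewrite /= andbT big_ord0 mulr1 => ->.
move=> /= /andP[xN yw]; rewrite inE negb_or => /andP[/andP[xy _] uw].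
rewrite IH // big_ord_recl /= !mulrA; congr (_ * _ * _).
by rewrite /gap; case: ltngtP xy; rewrite ?mulr1 ?mul1r.
Qed.

Lemma weight_prod (a b : nat -> C) N w : all (gtn N) w -> uniq w ->
  weight a b w = \prod_(i < size w)
      ((if (nth N (N :: w) i > nth N w i)%N then a (nth N w i) else 1) *
       (if (nth N w i < nth N w i.+1)%N then b (nth N w i) else 1)).
Proof.
case: w => [|x w]; first by rewrite big_ord0.
move=> allw uw; rewrite /weight (tail_weight_prod _ _ allw uw).
rewrite big_ord_recl /= mulrA.
by move: allw => /= /andP[-> _].
Qed.

Lemma weight_map_addn (a b : nat -> C) n v :
  weight a b (map (addn n) v) = weight (a \o addn n) (b \o addn n) v.
Proof.
case: v => //= x v; congr (_ * _).
by elim: v x => //= y v IH x; rewrite IH /gap ltn_add2l.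
Qed.

Variables (n : nat) (z : 'I_(n + n) -> C) (a b : nat -> C).
Hypothesis az : forall i : 'I_n, a i = z (lshift n i).
Hypothesis bz : forall i : 'I_n, b i = z (rshift n i).

Lemma eval_eulerian_weight s :
  (eulerian_weight C s).@[z] = weight a b (word s).
Proof.
have meval_prod (B : {set 'I_n}) (F : 'I_n -> 'I_(n + n)) :
    (\prod_(e in B) 'X_(F e) : {mpoly C[n + n]}).@[z] = \prod_(e in B) z (F e).
  by rewrite rmorph_prod /=; apply: eq_bigr => e _; rewrite mevalXU.
have pinj (A : {pred 'I_n}) : {in A &, injective (fun i => s i)}.
  by move=> i j _ _ /perm_inj.
have letterE k : letter s k.+1 = nth n (word s) k.
  rewrite /letter; case: insubP => [i _ <-|]; first by rewrite nth_word.
  by rewrite -leqNgt => nk; rewrite nth_default // size_word.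
have letterE' k : letter s k = nth n (n :: word s) k by case: k.
rewrite mevalM !meval_prod !(big_imset _ (@pinj _)).
rewrite (weight_prod _ _ (word_lt s) (word_uniq s)) size_word big_split.
rewrite big_mkcond [X in _ * X = _]big_mkcond.
congr (_ * _); apply: eq_bigr => i _; rewrite inE letterE.
  by rewrite letterE' nth_word az.
by rewrite letterE nth_word bz.
Qed.

Lemma eval_eulerian_poly (P : lposet n) :
  (eulerian_poly C P).@[z] =
    \sum_(w <- permutations (iota 0 n) | compatible P w) weight a b w.
Proof.
rewrite -(perm_big _ (words_permutations n)) big_map big_enum_cond /=.
rewrite raddf_sum; apply: eq_big => [s|s _].
  by rewrite jordan_holder_word.
exact: eval_eulerian_weight.
Qed.

End EvalWeight.

Lemma stable_eulerianP (R : realType) n (P : lposet n) :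
  stable (eulerian_poly R[i] P) <->
  forall a b : nat -> R[i],
    (forall e, 0 < complex.Im (a e)) -> (forall e, 0 < complex.Im (b e)) ->
    \sum_(w <- permutations (iota 0 n) | compatible P w) weight a b w != 0.
Proof.
split=> [Pst a b a0 b0 | Pst z z0].
  pose z (e : 'I_(n + n)) := match split e with inl i => a i | inr i => b i end.
  rewrite -(@eval_eulerian_poly _ n z) => [|i|i]; first 1 last.
  - by rewrite /z (unsplitK (inl i)).
  - by rewrite /z (unsplitK (inr i)).
  by apply: Pst => e; rewrite /z; case: split.
(* The value outside the range is ['i], which keeps all imaginary parts positive. *)
pose a k := if insub k is Some i then z (lshift n i) else 'i%C.
pose b k := if insub k is Some i then z (rshift n i) else 'i%C.
rewrite (@eval_eulerian_poly _ n z a b) => [|i|i]; first last.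
- by rewrite /b valK.
- by rewrite /a valK.
apply: Pst => k; rewrite ?/a ?/b; case: insub => [i|] //=; exact: ltr01.
Qed.

(** * Words of a disjoint union as shuffles *)

Section DisjointUnion.
Variables (n m : nat) (P : lposet n) (Q : lposet m).

(** No relation joins a small letter to a large one, so only pairs inside one of the two subwords
    matter. *)
Lemma compatible_dunion w : all (gtn (n + m)%N) w ->
  compatible (dunion P Q) w =
    compatible P (filter (gtn n) w) &&
    compatible Q (map (fun y => (y - n)%N) (filter (predC (gtn n)) w)).
Proof.
have relE x y : (x < n + m)%N -> (y < n + m)%N -> nat_rel (dunion P Q) x y =
    nat_rel P x y ||
      [&& (n <= x)%N, (n <= y)%N & nat_rel Q (x - n)%N (y - n)%N].
  have ordE k : (k < n + m)%N -> exists i : 'I_n + 'I_m, k = @unsplit n m i.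
    by move=> kN; exists (split (Ordinal kN)); rewrite splitK.
  have relP_big i j : (n <= i)%N || (n <= j)%N -> nat_rel P i j = false.
    rewrite /nat_rel; case: insubP => [i' i'n _|//].
    by case: insubP => [j' j'n _|//]; rewrite leqNgt i'n leqNgt j'n.
  move=> /ordE[i ->] /ordE[j ->]; rewrite nat_rel_ord /= /dunion_rel !unsplitK.
  case: i j => [i|i] [j|j] /=.
  - by rewrite nat_rel_ord leqNgt ltn_ord orbF.
  - by rewrite relP_big ?leq_addr ?orbT // leqNgt ltn_ord.
  - by rewrite relP_big ?leq_addr // leqNgt ltn_ord.
  - by rewrite relP_big ?leq_addr // !addKn nat_rel_ord.
elim: w => [|x w IH] //= /andP[xN wN].
rewrite IH // {IH} -/(compatible _ _).
have [xn|nx] := ltnP x n; rewrite /= ?all_map ?all_filter.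
  rewrite andbA; congr (_ && _ && _); apply: eq_in_all => y yw /=.
  have /= yN := allP wN y yw.
  rewrite relE // [X in [&& _, X & _]]leqNgt xn andbF orbF.
  by case: ltnP => //= ny; rewrite /nat_rel insubN // -leqNgt.
rewrite andbCA; congr (_ && (_ && _)); apply: eq_in_all => y yw /=.
have /= yN := allP wN y yw.
rewrite relE // nx -leqNgt implybE negb_or negb_and.
by rewrite /nat_rel [insub x]insubN -?leqNgt //; case: insub.
Qed.

(** After exchanging the sums, each [w] meets exactly one pair [(u, v)]: its small letters and its
    large letters shifted down by [n]. *)
Lemma sum_dunion (V : nmodType) (F : seq nat -> V) :
  \sum_(w <- permutations (iota 0 (n + m)%N) | compatible (dunion P Q) w) F w =
  \sum_(u <- permutations (iota 0 n) | compatible P u)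
    \sum_(v <- permutations (iota 0 m) | compatible Q v)
      \sum_(w <- shuffles u (map (addn n) v)) F w.
Proof.
pose lo := filter (gtn n); pose hi := filter (predC (gtn n)).
have all_lo u : perm_eq u (iota 0 n) -> all (gtn n) u.
  by move=> /perm_all->; apply/allP => e; rewrite mem_iota.
have all_hi v : all (predC (gtn n)) (map (addn n) v).
  by apply/allP => _ /mapP[e _ ->] /=; rewrite -leqNgt leq_addr.
have iotaE : iota 0 (n + m)%N = iota 0 n ++ map (addn n) (iota 0 m).
  by rewrite iotaD add0n -iotaDl addn0.
have lo_iota : lo (iota 0 (n + m)%N) = iota 0 n.
  rewrite /lo iotaE filter_cat (all_filterP (all_lo _ (perm_refl _))).
  by rewrite filter_predC_nil ?cats0.
have hi_iota : hi (iota 0 (n + m)%N) = map (addn n) (iota 0 m).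
  rewrite /hi iotaE filter_cat (all_filterP (all_hi _)).
  rewrite filter_predC_nil // (eq_all (a2 := gtn n)) ?all_lo // => e /=.
  exact: negbK.
pose sub_n := map (fun y => (y - n)%N).
have sub_nK v : sub_n (map (addn n) v) = v.
  by rewrite /sub_n -map_comp map_id_in // => e _ /=; rewrite addKn.
have hiK w : map (addn n) (sub_n (hi w)) = hi w.
  rewrite /sub_n -map_comp map_id_in // => e /=.
  by rewrite mem_filter /= -leqNgt => /andP[/subnKC].
have perm_parts w : perm_eq w (iota 0 (n + m)%N) =
    perm_eq (lo w) (iota 0 n) && perm_eq (sub_n (hi w)) (iota 0 m).
  apply/idP/andP => [pw|[plo phi]].
    rewrite -lo_iota -(sub_nK (iota 0 m)) -hi_iota.
    by split; [|apply: perm_map]; apply: perm_filter.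
  rewrite -(perm_filterC (gtn n) w) iotaE perm_cat // -[X in perm_eq X _]hiK.
  exact: perm_map.
have sum_sh u v :
    u \in permutations (iota 0 n) -> v \in permutations (iota 0 m) ->
    \sum_(w <- shuffles u (map (addn n) v)) F w =
      \sum_(w <- permutations (iota 0 (n + m)%N) |
        (u == lo w) && (v == sub_n (hi w))) F w.
  rewrite !mem_permutations => up vp; rewrite -[RHS]big_filter; apply: perm_big.
  apply: uniq_perm; first exact: shuffles_uniq (all_lo _ up) (all_hi _).
    by rewrite filter_uniq ?permutations_uniq.
  move=> w; rewrite (mem_shuffles _ (all_lo _ up) (all_hi _)) mem_filter.
  rewrite mem_permutations perm_parts [u == _]eq_sym -/(lo _) -/(hi _).
  have -> : (hi w == map (addn n) v) = (v == sub_n (hi w)).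
    by apply/eqP/eqP => [->|->]; rewrite ?sub_nK ?hiK.
  by case: andP => // -[/eqP-> /eqP<-]; rewrite up vp.
have sum_pred1 (r : seq (seq nat)) (c : pred (seq nat)) G w :
    uniq r -> w \in r ->
    \sum_(u <- r | c u && (u == w)) G u = (if c w then G w else 0) :> V.
  move=> ur wr; rewrite big_mkcondl -big_filter.
  by rewrite (filter_pred1_uniq ur wr) big_seq1.
transitivity (\sum_(u <- permutations (iota 0 n) | compatible P u)
    \sum_(v <- permutations (iota 0 m) | compatible Q v)
      \sum_(w <- permutations (iota 0 (n + m)%N))
        if (u == lo w) && (v == sub_n (hi w)) then F w else 0); last first.
  rewrite big_seq_cond [RHS]big_seq_cond; apply: eq_bigr => u /andP[up _].
  rewrite big_seq_cond [RHS]big_seq_cond; apply: eq_bigr => v /andP[vp _].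
  by rewrite sum_sh // -big_mkcond.
under [RHS]eq_bigr do rewrite exchange_big.
rewrite [RHS]exchange_big big_mkcond big_seq [RHS]big_seq; apply: eq_bigr => w.
rewrite mem_permutations => /[dup] pw; rewrite perm_parts => /andP[plo phi].
rewrite compatible_dunion; last first.
  by rewrite (perm_all _ pw); apply/allP => e; rewrite mem_iota.
rewrite -/(lo w) -/(hi w) -/(sub_n (hi w)).
transitivity (
  \sum_(u <- permutations (iota 0 n) | compatible P u && (u == lo w))
    \sum_(v <- permutations (iota 0 m) |
      compatible Q v && (v == sub_n (hi w))) F w).
  rewrite !sum_pred1 ?permutations_uniq ?mem_permutations //.
  by case: (compatible P _).
rewrite big_mkcondr; apply: eq_bigr => u _.
by case: (u == lo w); rewrite ?big1_eq // big_mkcondr.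
Qed.

End DisjointUnion.

(** * Stability for the disjoint union *)

Theorem theorem2p2 (R : realType) (n m : nat) (P : lposet n) (Q : lposet m) :
  stable (eulerian_poly R[i] P) ->
  stable (eulerian_poly R[i] Q) ->
  stable (eulerian_poly R[i] (dunion P Q)).
Proof.
move=> /stable_eulerianP Pst /stable_eulerianP Qst.
apply/stable_eulerianP => a b a0 b0; rewrite sum_dunion.
have sz k w : w \in permutations (iota 0 k) -> size w = k.
  by rewrite mem_permutations => /perm_size; rewrite size_iota.
have permutations_nil : permutations (iota 0 0) = [:: [::]] by [].
(* Empty posets are treated apart, since the coefficient formula requires both words to be
   nonempty. *)
have [n0|n_gt0] := posnP n.
  subst n; rewrite permutations_nil big_cons big_nil addr0 /=.
  under eq_bigr do rewrite big_seq1 weight_map_addn.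
  exact: Qst.
have [m0|m_gt0] := posnP m.
  subst m; under eq_bigr do
    rewrite permutations_nil big_cons big_nil addr0 shuffles_nilr big_seq1.
  exact: Pst.
pose f := \sum_(u <- permutations (iota 0 n) | compatible P u) lo_poly a b u.
pose h := \sum_(v <- permutations (iota 0 m) | compatible Q v)
  hi_poly a b (map (addn n) v).
have f0 t : complex.Im t <= 0 -> f.[t] != 0.
  move=> t0; have ta e := one_addM_neq0 t0 (a0 e).
  have tb e := one_addM_neq0 t0 (b0 e).
  (* Every [u] permutes [iota 0 n], so the product of denominators is common to all summands. *)
  suff -> : f.[t] = (\prod_(e <- iota 0 n) ((1 + t * a e) * (1 + t * b e))) *
      \sum_(u <- permutations (iota 0 n) | compatible P u)
         weight (fun e => a e / (1 + t * a e)) (fun e => b e / (1 + t * b e)) u.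
    rewrite mulf_neq0 ?Pst //.
    - by rewrite prodf_seq_neq0; apply/allP => e _ /=; rewrite mulf_neq0.
    - by move=> e; apply: Im_moebius_gt0.
    - by move=> e; apply: Im_moebius_gt0.
  rewrite horner_sum mulr_sumr big_seq_cond [RHS]big_seq_cond.
  apply: eq_bigr => u /andP[]; rewrite mem_permutations => up _.
  by rewrite horner_lo_poly // (perm_big _ up).
have h0 : lower_roots h.
  move=> s s0; rewrite horner_sum.
  under eq_bigr do rewrite horner_hi_poly weight_map_addn.
  by apply: Qst => e /=; rewrite ImD ltr_wpDr.
suff -> : \sum_(u <- permutations (iota 0 n) | compatible P u)
    \sum_(v <- permutations (iota 0 m) | compatible Q v)
      \sum_(w <- shuffles u (map (addn n) v)) weight a b w =
    \sum_(k < n) f`_k * h`_k.+1.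
  apply: sum_coef_neq0 => //.
    rewrite /f big_seq_cond; apply: (leq_trans (size_sum _ _ _)).
    apply/bigmax_leqP_seq => u _ /andP[/sz un _]; rewrite -[leqRHS]un.
    by rewrite size_lo_poly // -size_eq0 un -lt0n.
  (* The top coefficient counts the compatible words of [Q]; if it vanished, [h] would be an empty
     sum, against [h0]. *)
  have hm : h`_m.+1 =
      (size [seq v <- permutations (iota 0 m) | compatible Q v])%:R.
    rewrite coef_sum -big_filter big_seq -sum1_size natr_sum [RHS]big_seq.
    apply: eq_bigr => v; rewrite mem_filter => /andP[_ /sz vm].
    have vn0 : map (addn n) v != [::] by rewrite -size_eq0 size_map vm -lt0n.
    by have [_] := lead_hi_poly a b vn0; rewrite size_map vm.
  rewrite (leq_trans (n := m.+2)) // ltnNge; apply/negP => /leq_sizeP.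
  move/(_ m.+1 (leqnn _))/eqP; rewrite hm pnatr_eq0 size_eq0 => /eqP Q0.
  have := h0 0 (lexx _).
  by rewrite /h -big_filter Q0 big_nil hornerC eqxx.
under [RHS]eq_bigr do rewrite !coef_sum big_distrlr /=.
rewrite [RHS]exchange_big /= big_seq_cond [RHS]big_seq_cond.
apply: eq_bigr => u /andP[up _].
rewrite [RHS]exchange_big /= big_seq_cond [RHS]big_seq_cond.
apply: eq_bigr => v /andP[vp _].
have [un vm] := (sz _ _ up, sz _ _ vp).
rewrite (@sum_shuffles _ _ _ n) ?un //.
- move: up; rewrite mem_permutations => /perm_all->.
  by apply/allP => e; rewrite mem_iota.
- by apply/allP => _ /mapP[e _ ->] /=; rewrite leq_addr.
- by rewrite -size_eq0 un -lt0n.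
- by rewrite -size_eq0 size_map vm -lt0n.
Qed.
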